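(* Let $G$ be a graph of order $n\ge 2$, different from $\overline{K_n}$ (the graph on $n$ vertices without edges). Then $$\gamma_R(G)+\frac{n}{2}\le \gamma_R(G\odot K_1)\le \gamma_R(G)+n-1.$$
   Context: All graphs are finite, undirected, without loops or multiple edges. The order of a graph is its number of vertices. The corona graph $G\odot K_1$ is obtained from $G$ by attaching one new pendant vertex to each vertex of $G$. A Roman dominating function on a graph with vertex set $V$ is a map $f:V\to\{0,1,2\}$ such that every vertex $v$ with $f(v)=0$ has a neighbor $u$ with $f(u)=2$; its weight is $f(V)=\sum_{u\in V}f(u)$. The Roman domination number $\gamma_R(G)$ is the minimum weight of a Roman dominating function on $G$. *)

(* Defs.v *)
From mathcomp Require Import all_boot all_order all_algebra.

Set Implicit Arguments.
Unset Strict Implicit.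
Unset Printing Implicit Defensive.

Record sgraph := SGraph {
  svertex :> finType;
  adj : rel svertex;
  adj_sym : symmetric adj;
  adj_irrefl : irreflexive adj
}.

Definition sgraph_iso (G H : sgraph) : Prop :=
  exists2 h : G -> H, bijective h & forall x y, adj (h x) (h y) = adj x y.

Section Edgeless.
Variable n : nat.
Definition edgeless_adj : rel 'I_n := fun _ _ => false.
Lemma edgeless_adj_sym : symmetric edgeless_adj.
Proof. by []. Qed.
Lemma edgeless_adj_irrefl : irreflexive edgeless_adj.
Proof. by []. Qed.
Definition edgeless_graph : sgraph :=
  SGraph edgeless_adj_sym edgeless_adj_irrefl.
End Edgeless.

Section Corona.
Variable G : sgraph.
(* [inl x] is the vertex x of G; [inr x] is the pendant vertex attached to x. *)
Definition corona_adj : rel (G + G)%type := fun u v =>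
  match u, v with
  | inl x, inl y => adj x y
  | inl x, inr y => x == y
  | inr x, inl y => x == y
  | inr _, inr _ => false
  end.
Lemma corona_adj_sym : symmetric corona_adj.
Proof. by move=> [x|x] [y|y] //=; [exact: adj_sym | exact: eq_sym ..]. Qed.
Lemma corona_adj_irrefl : irreflexive corona_adj.
Proof. by move=> [x|x] //=; exact: adj_irrefl. Qed.
Definition corona : sgraph := SGraph corona_adj_sym corona_adj_irrefl.
End Corona.

Section Roman.
Variable G : sgraph.
Implicit Type f : {ffun G -> 'I_3}.

Definition roman_dominating f : bool :=
  [forall v, (f v == 0 :> nat) ==> [exists u, adj v u && (f u == 2 :> nat)]].

Definition rweight f : nat := \sum_(u : G) f u.

Definition const1 : {ffun G -> 'I_3} := [ffun=> inord 1].

Lemma const1_roman : roman_dominating const1.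
Proof. by apply/forallP=> v; rewrite ffunE inordK. Qed.

Definition roman_domination_number : nat :=
  rweight [arg min_(f < const1 | roman_dominating f) rweight f]%N.

(* The default value of [arg min] satisfies the predicate, so this is the
   minimum weight. *)
Lemma roman_domination_numberP :
  (exists2 f, roman_dominating f & rweight f = roman_domination_number) /\
  (forall f, roman_dominating f -> roman_domination_number <= rweight f).
Proof.
rewrite /roman_domination_number.
by case: arg_minnP => [|f fR fmin]; [exact: const1_roman | split=> //; exists f].
Qed.

End Roman.

(* Main.v *)
Require Import Defs.
From mathcomp Require Import all_boot all_order all_algebra.
From mathcomp Require Import zify lra.
Import GRing.Theory Num.Theory.
Local Open Scope ring_scope.

(**
  Upper bound: a minimum Roman dominating function f of G taking the value 2
  somewhere extends to the corona by giving 1 to every pendant vertex whose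
  support vertex is not labelled 2.  If no minimum function takes the value 2
  then gamma_R(G) = n, and one edge labelled (2, 0), with 1 elsewhere, is again
  a minimum function.

  Lower bound: let g be Roman dominating on the corona and let a be the number
  of vertices of G labelled 2.  A pendant pair weighs at least 1, and at least
  2 on those a vertices, so n + a <= w(g).  Restricting g to G, with 1 on the
  vertices that are dominated only by their pendant vertex, saves at least 1
  on every other pair, so gamma_R(G) + n - a <= w(g).  Add the two and use
  gamma_R(G) <= n.
*)

Set Implicit Arguments.
Unset Strict Implicit.

Lemma roman_dominatingP (G : sgraph) (f : {ffun G -> 'I_3}) :
  reflect (forall v, f v = 0%N :> nat -> exists2 u, adj v u & f u = 2%N :> nat)
          (roman_dominating f).
Proof.
apply: (iffP forallP) => [fR v /eqP fv0 | fR v].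
  by have /existsP[u /andP[vu /eqP fu2]] := implyP (fR v) fv0; exists u.
apply/implyP => /eqP /fR[u vu fu2].
by apply/existsP; exists u; rewrite vu fu2.
Qed.

Arguments roman_dominatingP {G f}.

Section RomanBounds.
Local Open Scope nat_scope.
Variable G : sgraph.
Implicit Types (f : {ffun G -> 'I_3}) (g : {ffun corona G -> 'I_3}).

Lemma roman_domination_number_le_order : roman_domination_number G <= #|G|.
Proof.
have [_ /(_ _ (const1_roman G))] := roman_domination_numberP G.
by rewrite /rweight (eq_bigr (fun=> 1)) ?sum1_card // => u _; rewrite ffunE inordK.
Qed.

Lemma rweight_corona g : rweight g = \sum_(x : G) (g (inl x) + g (inr x)).
Proof. by rewrite /rweight big_sumType /= big_split. Qed.

Lemma corona_roman_lower g : roman_dominating g ->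
  2 * roman_domination_number G + #|G| <= 2 * rweight g.
Proof.
move=> /roman_dominatingP gR.
(* The only neighbour of a pendant vertex is its support vertex, so the 2 must sit there. *)
have pendant x : g (inr x) = 0 :> nat -> g (inl x) = 2 :> nat.
  by move=> /gR[[y|y]] //= /eqP <-.
pose f : {ffun G -> 'I_3} := [ffun x =>
  if (g (inl x) == 0 :> nat) && (g (inr x) == 2 :> nat) then inord 1
  else g (inl x)].
have fR : roman_dominating f.
  apply/roman_dominatingP => x; rewrite ffunE.
  case: ifP => [_|]; first by rewrite inordK.
  move=> gx2 gx0; have [[y|y] /= xy gy2] := gR _ gx0.
    by exists y => //; rewrite ffunE gy2.
  (* Here the neighbour labelled 2 is the pendant vertex of [x], the case in which [f x] was set to
     1. *)
  by move: gx2; rewrite (eqP xy) gy2 -(eqP xy) gx0.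
pose a := \sum_(x : G) (g (inl x) == 2 :> nat).
have fa : rweight f + #|G| <= rweight g + a.
  rewrite rweight_corona /rweight /a -sum1_card -!big_split /=.
  (* Compared vertex by vertex; [pendant] excludes the label pairs (0, 0) and (1, 0), where the
     inequality would fail. *)
  apply: leq_sum => x _; rewrite ffunE; have := @pendant x.
  case: ifP => [/andP[/eqP-> /eqP->]|]; rewrite ?inordK //.
  case: (g (inl x)) => -[|[|[|]]] //= ?; case: (g (inr x)) => -[|[|[|]]] //=; lia.
have na : #|G| + a <= rweight g.
  rewrite rweight_corona /a -sum1_card -big_split /=.
  apply: leq_sum => x _; have := @pendant x.
  case: (g (inl x)) => -[|[|[|]]] //= ?; case: (g (inr x)) => -[|[|[|]]] //=; lia.
have [_ /(_ _ fR)] := roman_domination_numberP G.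
by have := roman_domination_number_le_order; lia.
Qed.

(** Strictness comes from [z]: its pendant vertex gets 0, while every other pendant vertex costs at
    most 1. *)
Lemma corona_roman_upper f z : roman_dominating f -> f z = 2 :> nat ->
  roman_domination_number (corona G) < rweight f + #|G|.
Proof.
move=> /roman_dominatingP fR fz2.
pose g : {ffun corona G -> 'I_3} := [ffun u => match u with
  | inl x => f x
  | inr x => if f x == 2 :> nat then inord 0 else inord 1 end].
have gR : roman_dominating g.
  apply/roman_dominatingP => -[x|x]; rewrite ffunE.
    by move=> /fR[y xy fy2]; exists (inl y); rewrite ?ffunE.
  case: eqP => [fx2 _|_]; last by rewrite inordK.
  by exists (inl x); rewrite /= ?ffunE.
have [_ /(_ _ gR) /leq_ltn_trans->] // := roman_domination_numberP (corona G).
rewrite rweight_corona /rweight -sum1_card -big_split /=.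
rewrite (bigD1 z) //= [ltnRHS](bigD1 z) //= !ffunE fz2 inordK //.
rewrite -addSn leq_add // leq_sum // => x _.
by rewrite !ffunE leq_add2l; case: ifP => _; rewrite inordK.
Qed.

Lemma min_roman_with_two (x y : G) : adj x y ->
  exists2 f : {ffun G -> 'I_3}, roman_dominating f &
  rweight f = roman_domination_number G /\ exists z, f z = 2 :> nat.
Proof.
move=> xy; have [[f fR fw] fmin] := roman_domination_numberP G.
have [z /eqP fz2 | no2] := pickP (fun z => f z == 2 :> nat).
  by exists f => //; split=> //; exists z.
have yx : y != x by apply: contraTneq xy => ->; rewrite adj_irrefl.
pose h : {ffun G -> 'I_3} :=
  [ffun u => if u == x then inord 2 else if u == y then inord 0 else inord 1].
have hx : h x = 2 :> nat by rewrite ffunE eqxx inordK.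
have hR : roman_dominating h.
  apply/roman_dominatingP => v hv; exists x => //; move: hv; rewrite ffunE.
  case: eqP => [_|_]; first by rewrite inordK.
  by case: eqP => [-> _|_]; rewrite ?inordK // adj_sym.
exists h => //; split; last by exists x.
apply/eqP; rewrite eqn_leq fmin // andbT -fw /rweight.
(* Without the label 2 nothing can dominate a 0, so [f] is constantly 1. *)
have f1 u : f u = 1 :> nat.
  have := no2 u; case fu: (nat_of_ord (f u)) (ltn_ord (f u)) => [|[|[|]]] // _ _.
  have [w _ /eqP] := roman_dominatingP fR u fu.
  by rewrite no2.
(* Only [x] and [y] differ: [h] puts 2 + 0 there and [f] puts 1 + 1. *)
rewrite (bigD1 x) //= [X in _ + X <= _](bigD1 y) //=.
rewrite [leqRHS](bigD1 x) //= [X in _ <= _ + X](bigD1 y) //= hx.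
rewrite !f1 ffunE (negPf yx) eqxx inordK // !addnA leq_add // leq_sum // => u.
by move=> /andP[/negPf ux /negPf uy]; rewrite ffunE ux uy inordK ?f1.
Qed.

Lemma edge_of_non_edgeless :
  ~ sgraph_iso G (edgeless_graph #|G|) -> exists x y : G, adj x y.
Proof.
move=> hG; have [[x y] /= xy | no_edge] := pickP (fun p : G * G => adj p.1 p.2).
  by exists x, y.
(* With no edges on either side every bijection is an isomorphism, so an enumeration of the vertices
   serves. *)
case: hG; exists (@enum_rank G); first exact: enum_rank_bij.
by move=> x y; rewrite (no_edge (x, y)).
Qed.

End RomanBounds.

Unset Implicit Arguments.
Set Strict Implicit.

Theorem corollary11 (G : sgraph) (n : nat) (hn : #|G| = n) (n_ge2 : (2 <= n)%N)
    (hG : ~ sgraph_iso G (edgeless_graph n)) :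
  (roman_domination_number G)%:R + n%:R / 2%:R
    <= (roman_domination_number (corona G))%:R :> rat
  /\ (roman_domination_number (corona G))%:R
    <= (roman_domination_number G)%:R + n%:R - 1 :> rat.
Proof.
subst n; split.
  have [[g gR <-] _] := roman_domination_numberP (corona G).
  have := corona_roman_lower gR.
  by rewrite -(ler_nat rat) natrD !natrM; lra.
have [x [y xy]] := edge_of_non_edgeless hG.
have [f fR [<- [z fz2]]] := min_roman_with_two xy.
have := corona_roman_upper fR fz2.
by rewrite -(ler_nat rat) -addn1 !natrD; lra.
Qed.
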